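(* Consider the personalized mean-field game with data $(\mathcal S,\mathcal A,T,\mu_0,\{P_t\},\{r_t\})$ described in the context, and the feasibility problem $$ \begin{array}{ll} \text{minimize}_{y,z,d,L} & 0\\ \text{subject to} & A_Ld=b',\quad A_L^\top y+z=c_L,\\ & z^\top d=0,\quad d\ge0,\quad z\ge0,\\ & A_LL=b,\quad L\ge0,\\ & L_t(s,a)\sum_{a'\in\mathcal A}d_t(s,a')=d_t(s,a)\sum_{a'\in\mathcal A}L_t(s,a'),\quad\forall s\in\mathcal S,\ a\in\mathcal A,\ t\in\mathcal T, \end{array}\qquad(\star\star) $$ with $y\in\mathbb R^{S(T+1)}$ and $z,d,L\in\mathbb R^{SA(T+1)}$. Finding refined Nash equilibrium solutions of the personalized mean-field game is equivalent to solving $(\star\star)$, in the following sense. If $(\pi,L)$ is a refined Nash equilibrium solution, then $(y,z,d,L)$ is a solution to $(\star\star)$ for some $y,z,d$. Conversely, if $(y,z,d,L)$ is a solution to $(\star\star)$, then for every $\pi\in\Pi(d)$, $(\pi,L)$ is a refined Nash equilibrium solution.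
   Context: **Game data.** $\mathcal S,\mathcal A$ are finite sets with $|\mathcal S|=S$, $|\mathcal A|=A$; $T$ is a finite time horizon and $\mathcal T=\{0,1,\dots,T\}$. For a finite set $X$, $\Delta(X)$ is the set of probability vectors on $X$. $\mu_0\in\Delta(\mathcal S)$ is the initial distribution. For $t\in\mathcal T$, $s\in\mathcal S$, $a\in\mathcal A$ and $\ell\in\Delta(\mathcal S\times\mathcal A)$ there are a transition probability $P_t(\cdot|s,a,\ell)\in\Delta(\mathcal S)$ ($P_T$ plays no role) and a reward $r_t(s,a,\ell)\in\mathbb R$, with $\sup_{t,s,a,\ell}|r_t(s,a,\ell)|<\infty$. A policy (sequence) is $\pi=\{\pi_t\}_{t\in\mathcal T}$ with $\pi_t(\cdot|s)\in\Delta(\mathcal A)$; a mean-field flow is $L=\{L_t\}_{t\in\mathcal T}$ with $L_t\in\Delta(\mathcal S\times\mathcal A)$. **Refined Nash equilibrium solution.** $(\pi,L)$ is a refined Nash equilibrium solution if: (1) for every initial state $s\in\mathcal S$, $\pi$ maximizes $\mathbb E\big[\sum_{t=0}^Tr_t(s_t,a_t,L_t)\,|\,s_0=s\big]$ over all policies, where $s_{t+1}\sim P_t(\cdot|s_t,a_t,L_t)$ for $0\le t\le T-1$ and $a_t\sim\pi_t(\cdot|s_t)$ for $t\in\mathcal T$; and (2) $L_t$ is the law of $(s_t,a_t)$ when $s_0\sim\mu_0$, i.e. $L_0(s,a)=\mu_0(s)\pi_0(a|s)$ and $L_{t+1}(s',a')=\pi_{t+1}(a'|s')\sum_{s,a}L_t(s,a)P_t(s'|s,a,L_t)$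 for $0\le t\le T-1$. **The set $\Pi(d)$.** $\pi\in\Pi(d)$ iff $\pi_t(a|s)=d_t(s,a)/\sum_{a'}d_t(s,a')$ whenever $\sum_{a'}d_t(s,a')>0$, and $\pi_t(\cdot|s)$ is an arbitrary element of $\Delta(\mathcal A)$ otherwise. **Vectors and matrices.** Functions on $\mathcal S\times\mathcal A$ are flattened into vectors in $\mathbb R^{SA}$ in column-major order (state index running fastest), and $L=(L_0,\dots,L_T)$, $d=(d_0,\dots,d_T)\in\mathbb R^{SA(T+1)}$. Let $Z=[I_S,\dots,I_S]\in\mathbb R^{S\times SA}$ ($A$ copies of the identity), and let $W_t(L_t)\in\mathbb R^{S\times SA}$ be the matrix whose row indexed by $s'$ is the flattened vector $P_t(s'|\cdot,\cdot,L_t)$. Then $c_L=(-r_0(\cdot,\cdot,L_0),\dots,-r_T(\cdot,\cdot,L_T))$, $b=(0,\dots,0,\mu_0)\in\mathbb R^{S(T+1)}$, $b'=(0,\dots,0,\tfrac1S\mathbf 1)\in\mathbb R^{S(T+1)}$ with $\mathbf 1\in\mathbb R^S$ the all-one vector, and $A_L\in\mathbb R^{S(T+1)\times SA(T+1)}$ has $T+1$ block rows: for $t=0,\dots,T-1$, block row $t$ has $W_t(L_t)$ in block column $t$, $-Z$ in block column $t+1$ and zeros elsewhere; the last block row has $Z$ in block column $0$ and zeros elsewhere. Since $P_t,r_t$ are defined only for $L_t\in\Delta(\mathcal S\times\mathcal A)$, the variable $L$ ranges over vectors with $L_t\in\Delta(\mathcal S\times\mathcal A)$ for all $t$. *)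

(* Defs.v *)
(* MathComp world; [R : realType] is the field of real numbers. *)
From HB Require Import structures.
From mathcomp Require Import all_boot all_order all_algebra.
From mathcomp Require Import reals.

Set Implicit Arguments.
Unset Strict Implicit.
Unset Printing Implicit Defensive.

Import Order.TTheory GRing.Theory Num.Theory.

Local Open Scope ring_scope.

Definition is_distr (R : realType) (X : finType) (p : {ffun X -> R}) : Prop :=
  (forall x, 0 <= p x) /\ \sum_(x : X) p x = 1.

(* [trans g t s a l s'] is P_t(s' | s, a, l) and [reward g t s a l] is
   r_t(s, a, l).  Both are total in [l], but nothing is assumed, and nothing
   is ever used, about their values when [l] is not a distribution. *)
Record mfgame (R : realType) (S A : finType) (T : nat) := MFGame {
  mu0 : {ffun S -> R};
  trans : 'I_T.+1 -> S -> A -> {ffun S * A -> R} -> {ffun S -> R};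
  reward : 'I_T.+1 -> S -> A -> {ffun S * A -> R} -> R;
  mu0_distr : is_distr mu0;
  trans_distr : forall t s a l, is_distr l -> is_distr (trans t s a l);
  reward_bounded : exists M : R,
    forall t s a l, is_distr l -> `|reward t s a l| <= M
}.

Section Game.
Variables (R : realType) (S A : finType) (T : nat).

Definition policy := 'I_T.+1 -> S -> {ffun A -> R}.
Definition flow := 'I_T.+1 -> {ffun S * A -> R}.

Definition is_policy (pi : policy) : Prop := forall t s, is_distr (pi t s).
Definition is_mfflow (L : flow) : Prop := forall t, is_distr (L t).

(* For t < T, the times t and t + 1 as elements of {0, ..., T}. *)
Definition cur_time (t : 'I_T) : 'I_T.+1 := widen_ord (leqnSn T) t.
Definition next_time (t : 'I_T) : 'I_T.+1 := lift ord0 t.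

Variable g : mfgame R S A T.

Section Trajectories.
Variables (pi : policy) (L : flow).

(* Probability of the trajectory tau = ((s_0, a_0), ..., (s_T, a_T)) when the
   initial state is s. *)
Definition traj_prob (s : S) (tau : {ffun 'I_T.+1 -> S * A}) : R :=
  ((tau ord0).1 == s)%:R
  * (\prod_(t < T.+1) pi t (tau t).1 (tau t).2)
  * (\prod_(t < T)
       trans g (cur_time t) (tau (cur_time t)).1 (tau (cur_time t)).2
             (L (cur_time t)) (tau (next_time t)).1).

Definition expected_reward (s : S) : R :=
  \sum_(tau : {ffun 'I_T.+1 -> S * A})
     traj_prob s tau
     * \sum_(t < T.+1) reward g t (tau t).1 (tau t).2 (L t).

Definition is_law : Prop :=
  (forall s a, L ord0 (s, a) = mu0 g s * pi ord0 s a) /\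
  (forall (t : 'I_T) s' a',
     L (next_time t) (s', a') =
       pi (next_time t) s' a'
       * \sum_(s : S) \sum_(a : A)
            L (cur_time t) (s, a)
            * trans g (cur_time t) s a (L (cur_time t)) s').

End Trajectories.

Definition refined_nash (pi : policy) (L : flow) : Prop :=
  [/\ is_policy pi,
      is_mfflow L,
      forall (s : S) (pi' : policy), is_policy pi' ->
        expected_reward pi' L s <= expected_reward pi L s
    & is_law pi L].

Definition in_Pi (d : flow) (pi : policy) : Prop :=
  forall t s,
    (0 < \sum_(a' : A) d t (s, a') ->
       forall a, pi t s a = d t (s, a) / \sum_(a' : A) d t (s, a')) /\
    (~~ (0 < \sum_(a' : A) d t (s, a')) -> is_distr (pi t s)).

(* R^(SA) and R^(SA(T+1)) are indexed by iterated sums of constants rather than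
   by products, so that flattening in column-major order (state index running
   fastest) and stacking over time are block-column constructions. *)
Definition dimSA : nat := (\sum_(a < #|A|) #|S|)%N.

Definition flat (f : {ffun S * A -> R}) : 'cV[R]_dimSA :=
  \mxcol_(a < #|A|) \col_(s < #|S|) f (enum_val s, enum_val a).

Definition flow_vec (L : flow) : 'cV[R]_(\sum_(t < T.+1) dimSA) :=
  \mxcol_(t < T.+1) flat (L t).

Definition unflat (v : 'cV[R]_dimSA) : {ffun S * A -> R} :=
  [ffun sa => submxcol v (enum_rank sa.2) (enum_rank sa.1) 0].

Definition vec_flow (v : 'cV[R]_(\sum_(t < T.+1) dimSA)) : flow :=
  fun t => unflat (submxcol v t).

Lemma flatK : cancel flat unflat.
Proof.
by move=> f; apply/ffunP=> -[s a]; rewrite ffunE /flat mxcolK mxE !enum_rankK.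
Qed.

Lemma unflatK : cancel unflat flat.
Proof.
move=> v; rewrite /flat -[RHS]submxcolK; apply/eq_mxcolP=> a.
by apply/colP=> s; rewrite mxE ffunE /= !enum_valK.
Qed.

Lemma flow_vecK (L : flow) (t : 'I_T.+1) : vec_flow (flow_vec L) t = L t.
Proof. by rewrite /vec_flow /flow_vec mxcolK flatK. Qed.

Lemma vec_flowK : cancel vec_flow flow_vec.
Proof.
move=> v; rewrite /flow_vec -[RHS]submxcolK.
by apply/eq_mxcolP=> t; rewrite /vec_flow unflatK.
Qed.

Definition Zmx : 'M[R]_(#|S|, dimSA) := \mxrow_(a < #|A|) 1%:M.

Definition Wmx (t : 'I_T.+1) (l : {ffun S * A -> R}) : 'M[R]_(#|S|, dimSA) :=
  \mxrow_(a < #|A|) \matrix_(s' < #|S|, s < #|S|)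
    trans g t (enum_val s) (enum_val a) l (enum_val s').

Definition Amx (L : flow) :
    'M[R]_(\sum_(i < T.+1) #|S|, \sum_(j < T.+1) dimSA) :=
  \mxblock_(i < T.+1, j < T.+1)
    (if (i < T)%N then
       if j == i :> nat then Wmx i (L i)
       else if j == i.+1 :> nat then - Zmx
       else 0
     else if j == 0%N :> nat then Zmx else 0).

Definition cvec (L : flow) : 'cV[R]_(\sum_(t < T.+1) dimSA) :=
  flow_vec (fun t => [ffun sa => - reward g t sa.1 sa.2 (L t)]).

(* (0, ..., 0, p); then b = last_block mu0 and b' = last_block (1/S, ..., 1/S). *)
Definition last_block (p : {ffun S -> R}) : 'cV[R]_(\sum_(i < T.+1) #|S|) :=
  \mxcol_(i < T.+1)
    (if i == T :> nat then \col_(s < #|S|) p (enum_val s) else 0).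

Definition bvec : 'cV[R]_(\sum_(i < T.+1) #|S|) := last_block (mu0 g).
Definition bvec' : 'cV[R]_(\sum_(i < T.+1) #|S|) :=
  last_block [ffun=> #|S|%:R^-1].

Definition nonneg (n : nat) (v : 'cV[R]_n) : Prop := forall i, 0 <= v i 0.

(* The objective being constant, solutions are the feasible points.  The first
   conjunct is the domain of the variable L: A_L and c_L are meaningful only for
   flows of distributions. *)
Definition solution (y : 'cV[R]_(\sum_(i < T.+1) #|S|))
    (z dv Lv : 'cV[R]_(\sum_(t < T.+1) dimSA)) : Prop :=
  let d := vec_flow dv in
  let L := vec_flow Lv in
  is_mfflow L /\
  [/\ Amx L *m dv = bvec' /\ (Amx L)^T *m y + z = cvec L,
      [/\ z^T *m dv = 0, nonneg dv & nonneg z],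
      Amx L *m Lv = bvec /\ nonneg Lv
    & forall s a t,
        L t (s, a) * \sum_(a' : A) d t (s, a') =
        d t (s, a) * \sum_(a' : A) L t (s, a')].

End Game.

(* Main.v *)
Require Import Defs.
From mathcomp Require Import all_boot all_order all_algebra.
From mathcomp Require Import reals boolp ring.

(** The problem (star-star) is the primal-dual optimality system of a linear
programme, coupled with the law of motion of the population.  Fix the flow [L];
each player then faces an ordinary Markov decision process of horizon [T].

Primal side.  A flow [d] satisfies [A_L d = last_block m] exactly when it
obeys the conservation law of state mass started from [m]
([Amx_flow_vec]).  If moreover [d_t(s,a) = pi_t(a|s) sum_a' d_t(s,a')], then [d]
is the state-action occupation of [pi] from [m], and
[sum_s m(s) E_s = sum_(t,x) d_t(x) r_t(x)], where [E_s] is the expected reward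
of [pi] from [s] ([mean_expected_reward]).

Dual side.  Up to signs and a shift in time, [y] is a function [V_t(s)], and
[A_L^T y + z = c_L] is the Bellman equation with slack,
[V_t(s) = r_t(s,a) + sum_s' P_t(s'|s,a) V_(t+1)(s') + z_t(s,a)], with
[V_(T+1) = 0] ([dual_feasibleP]).  Telescoping it along an occupation gives
[sum_s m(s) E_s = sum_s m(s) V_0(s) - z^T d] ([total_reward_bellman]).
So if [z >= 0], then [V_0] bounds the reward of every policy from every
state.  As the initial law [1/S] charges every state, [z^T d = 0] holds exactly
when [pi] attains this bound from all states at once
([optimal_iff_slack_cost0]).  This is why (star-star) starts [d] from the uniform
law and characterizes refined, rather than ordinary, equilibria.

From an equilibrium, take [d] to be the occupation of [pi] from the uniform law,
and [V] the optimal values obtained by backward induction: a greedy policy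
attains [V_0] ([optimal_values], [greedy_attains]), hence so does [pi], and
complementary slackness follows.  Conversely, a policy in [Pi(d)] drives [d],
hence is optimal from every state.  It also drives [L]: the proportionality
constraint gives this at the states charged by [d], and [L] vanishes at the
others, since a state unreachable from the uniform law under [pi] is unreachable
from [mu0] ([driven_by_proportional]). *)

Import Order.TTheory GRing.Theory Num.Theory.

Set Implicit Arguments.
Unset Strict Implicit.
Unset Printing Implicit Defensive.

(** * Induction and recursion over a finite horizon *)

Section Time.
Variable T : nat.

Lemma time_ind (P : 'I_T.+1 -> Prop) :
    P ord0 -> (forall t : 'I_T, P (cur_time t) -> P (next_time t)) ->
  forall t, P t.
Proof.
move=> P0 PS [n]; elim: n => [|n IHn] ltnT.
  by congr (P _): P0; apply: val_inj.
have /PS : P (cur_time (Ordinal (ltnT : (n < T)%N))).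
  by congr (P _): (IHn (ltnW ltnT)); apply: val_inj.
by congr (P _); apply: val_inj.
Qed.

Lemma time_last (P : 'I_T.+1 -> Prop) :
  (forall t : 'I_T, P (cur_time t)) -> P ord_max -> forall t, P t.
Proof.
move=> Pcur Pmax t; have [u|->] := unliftP ord_max t => [->|//].
by congr (P _): (Pcur u); apply: val_inj; rewrite /= /bump leqNgt ltn_ord.
Qed.

Lemma forward_recursion (X : Type) (x0 : X) (F : 'I_T.+1 -> X -> X) :
  exists q : 'I_T.+1 -> X,
    q ord0 = x0 /\ forall t : 'I_T, q (next_time t) = F (cur_time t) (q (cur_time t)).
Proof.
pose q := nat_rect (fun=> X) x0 (fun n x => F (inord n) x).
exists (fun t : 'I_T.+1 => q t); split=> // t.
by rewrite /= -[cur_time t]inord_val.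
Qed.

Lemma backward_recursion (X : Type) (x1 : X) (F : 'I_T.+1 -> X -> X) :
  exists q : 'I_T.+1 -> X,
    q ord_max = F ord_max x1 /\
    forall t : 'I_T, q (cur_time t) = F (cur_time t) (q (next_time t)).
Proof.
(* [q k] is the value when [k] steps remain, so the step with [k] left after
   it happens at time [T - k]. *)
pose q := nat_rect (fun=> X) x1 (fun k x => F (inord (T - k)) x).
exists (fun t : 'I_T.+1 => q (T - t).+1); split=> [|t].
  by rewrite /= subnn subn0 -[ord_max in RHS]inord_val.
have -> : (T - next_time t).+1 = T - cur_time t.
  by rewrite /= /bump leq0n add1n -subSn ?ltn_ord // subSS.
have {2}-> : cur_time t = inord (T - (T - cur_time t)).
  by rewrite subKn ?inord_val //= ltnW.
by [].
Qed.

End Time.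

Local Open Scope ring_scope.

(** * Additive functionals of finite Markov chains *)

Section Paths.
Variables (R : realType) (X : finType).

Lemma sum_ffun_cons (n : nat) (F : {ffun 'I_n.+1 -> X} -> R) :
  \sum_f F f =
  \sum_(x : X) \sum_(h : {ffun 'I_n -> X})
     F [ffun i => oapp h x (unlift ord0 i)].
Proof.
rewrite pair_bigA /=.
rewrite (reindex (fun p : X * {ffun 'I_n -> X} =>
                    [ffun i => oapp p.2 p.1 (unlift ord0 i)])) //=.
exists (fun f : {ffun 'I_n.+1 -> X} => (f ord0, [ffun i => f (lift ord0 i)])).
  move=> [x h] _ /=; rewrite ffunE unlift_none /=; congr pair.
  by apply/ffunP=> i; rewrite !ffunE liftK.
move=> f _; apply/ffunP=> i; rewrite ffunE.
by case: unliftP => [j|] -> //=; rewrite ffunE.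
Qed.

Lemma sum_ffun_ord1 (F : {ffun 'I_1 -> X} -> R) :
  \sum_f F f = \sum_(x : X) F [ffun=> x].
Proof.
rewrite (reindex (fun x : X => [ffun=> x])) //=.
exists (fun f : {ffun 'I_1 -> X} => f ord0) => [x _ | f _]; first by rewrite ffunE.
by apply/ffunP=> i; rewrite ffunE (ord1 i).
Qed.

(** The mass of paths equals the initial mass, because each transition preserves
it.  Letting [p] be arbitrary is what makes the induction go through: removing
the first state [x] of a path replaces [p] by the unnormalized
[fun x' => p x * k ord0 x x']. *)
Lemma path_mass (T : nat) (k : 'I_T -> X -> X -> R) (p : X -> R) :
    (forall t x, \sum_x' k t x x' = 1) ->
  \sum_(tau : {ffun 'I_T.+1 -> X})
     p (tau ord0) * \prod_(t < T) k t (tau (cur_time t)) (tau (next_time t))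
  = \sum_x p x.
Proof.
elim: T k p => [|T IH] k p k1.
  by rewrite sum_ffun_ord1; apply: eq_bigr => x _; rewrite big_ord0 mulr1 ffunE.
rewrite sum_ffun_cons; apply: eq_bigr => x _.
under eq_bigr => h _.
  rewrite big_ord_recl !ffunE.
  have -> : cur_time (ord0 : 'I_T.+1) = ord0 by apply: val_inj.
  rewrite unlift_none liftK /= mulrA.
  under eq_bigr => t _.
    have -> : cur_time (lift ord0 t) = lift ord0 (cur_time t) by apply: val_inj.
    rewrite /next_time !ffunE !liftK /=; over.
  over.
by rewrite (IH (fun t => k (lift ord0 t)) (fun x' => p x * k ord0 x x'))
  // -mulr_sumr k1 mulr1.
Qed.

(** Linearity of expectation for the chain with marginals [q] and transitions
[k].  Removing the first state [x] of the path isolates the term of time 0,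
whose weight reduces to [q ord0 x] by [path_mass]; summing the remaining terms
over [x] turns the initial weight into [q (next_time ord0)]. *)
Lemma path_additive (T : nat) (k : 'I_T -> X -> X -> R) (q f : 'I_T.+1 -> X -> R) :
    (forall t x, \sum_x' k t x x' = 1) ->
    (forall t x', q (next_time t) x' = \sum_x q (cur_time t) x * k t x x') ->
  \sum_(tau : {ffun 'I_T.+1 -> X})
     q ord0 (tau ord0)
     * \prod_(t < T) k t (tau (cur_time t)) (tau (next_time t))
     * \sum_(t < T.+1) f t (tau t)
  = \sum_(t < T.+1) \sum_x q t x * f t x.
Proof.
elim: T k q f => [|T IH] k q f k1 qS.
  rewrite sum_ffun_ord1 big_ord_recl big_ord0 addr0; apply: eq_bigr => x _.
  by rewrite big_ord0 mulr1 big_ord_recl big_ord0 addr0 !ffunE.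
have cur0 : cur_time (ord0 : 'I_T.+1) = ord0 by apply: val_inj.
have curS (t : 'I_T) : cur_time (lift ord0 t) = lift ord0 (cur_time t).
  by apply: val_inj.
pose w (h : {ffun 'I_T.+1 -> X}) :=
  \prod_(t < T) k (lift ord0 t) (h (cur_time t)) (h (next_time t)).
rewrite sum_ffun_cons [RHS]big_ord_recl.
(* [x] is the first state of the path and [h] the rest of it. *)
transitivity (\sum_x \sum_(h : {ffun 'I_T.+1 -> X})
    (q ord0 x * f ord0 x * (k ord0 x (h ord0) * w h) +
     q ord0 x * k ord0 x (h ord0) * (w h * \sum_(t < T.+1) f (lift ord0 t) (h t)))).
  apply: eq_bigr => x _; apply: eq_bigr => h _.
  rewrite big_ord_recl [in X in _ * X]big_ord_recl !ffunE cur0 unlift_none liftK /=.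
  under eq_bigr => t _ do rewrite curS /next_time !ffunE !liftK /=.
  rewrite -/(w h).
  under [\sum_(i < T.+1) _]eq_bigr => t _ do rewrite !ffunE !liftK /=.
  by ring.
under eq_bigr => x _.
  rewrite big_split /= -mulr_sumr (path_mass (k := fun t => k (lift ord0 t))) //.
  rewrite k1 mulr1; over.
rewrite big_split /=; congr (_ + _).
rewrite exchange_big /=.
under eq_bigr => h _.
  rewrite -mulr_suml.
  have -> : \sum_x q ord0 x * k ord0 x (h ord0) = q (next_time ord0) (h ord0).
    by rewrite qS cur0.
  rewrite mulrA; over.
rewrite (IH (fun t => k (lift ord0 t)) (fun t => q (lift ord0 t))
            (fun t => f (lift ord0 t))) // => t x'.
by rewrite [LHS]qS curS.
Qed.

End Paths.

(** * Occupations and their rewards *)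

Section GameTheory.
Variables (R : realType) (S A : finType) (T : nat) (g : mfgame R S A T).
Implicit Types (pi : policy R S A T) (L l d z : flow R S A T) (m : S -> R).
Implicit Types (V : 'I_T.+1 -> S -> R).

Lemma sum_stateaction (F : S * A -> R) :
  \sum_x F x = \sum_(s : S) \sum_(a : A) F (s, a).
Proof. by rewrite pair_bigA; apply: eq_bigr => -[]. Qed.

Definition flow_balance L m d : Prop :=
  (forall s, \sum_a d ord0 (s, a) = m s) /\
  (forall (t : 'I_T) s',
     \sum_a d (next_time t) (s', a) =
     \sum_s \sum_a d (cur_time t) (s, a)
                   * trans g (cur_time t) s a (L (cur_time t)) s').

(** The unnormalized form of [pi_t(a|s) = d_t(s,a) / sum_a' d_t(s,a')]: it
leaves [pi] free at the states without mass. *)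
Definition driven_by pi d : Prop :=
  forall t s a, d t (s, a) = pi t s a * \sum_a' d t (s, a').

Definition occupation pi L m d : Prop := flow_balance L m d /\ driven_by pi d.

Lemma is_law_occupation pi L :
  is_policy pi -> is_law g pi L <-> occupation pi L (mu0 g) L.
Proof.
move=> pi_pol; split=> [[L0 LS]|[[bal0 balS] drv]].
  have bal : flow_balance L (mu0 g) L.
    split=> [s|t s'].
      under eq_bigr do rewrite L0.
      by rewrite -mulr_sumr (pi_pol ord0 s).2 mulr1.
    under eq_bigr do rewrite LS.
    by rewrite -mulr_suml (pi_pol _ s').2 mul1r.
  split=> //; elim/time_ind => [|t _] s a; first by rewrite bal.1 L0 mulrC.
  by rewrite bal.2 LS.
by split=> [s a|t s' a']; rewrite drv ?bal0 ?balS // mulrC.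
Qed.

Lemma occupation_exists pi L m :
  is_policy pi -> exists d, occupation pi L m d.
Proof.
move=> pi_pol.
have [p [p0 pS]] := forward_recursion m (fun t (p : S -> R) s' =>
  \sum_s \sum_a p s * pi t s a * trans g t s a (L t) s').
pose d : flow R S A T := fun t => [ffun x => p t x.1 * pi t x.1 x.2].
have margE t s : \sum_a d t (s, a) = p t s.
  under eq_bigr do rewrite ffunE /=.
  by rewrite -mulr_sumr (pi_pol t s).2 mulr1.
exists d; split; last by move=> t s a; rewrite margE ffunE mulrC.
split=> [s|t s']; rewrite margE ?p0 // pS.
by apply: eq_bigr => s _; apply: eq_bigr => a _; rewrite ffunE.
Qed.

Lemma occupation_ge0 pi L m d :
    is_policy pi -> is_mfflow L -> (forall s, 0 <= m s) ->
  occupation pi L m d -> forall t x, 0 <= d t x.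
Proof.
move=> pi_pol flL m0 [[bal0 balS] drv]; elim/time_ind => [|t IH] [s a]; rewrite drv.
  by rewrite mulr_ge0 ?bal0 // (pi_pol _ _).1.
rewrite mulr_ge0 ?(pi_pol _ _).1 // balS.
apply: sumr_ge0 => s0 _; apply: sumr_ge0 => a0 _.
by rewrite mulr_ge0 // (trans_distr g _ _ _ (flL _)).1.
Qed.

Definition total_reward L d : R :=
  \sum_t \sum_x d t x * reward g t x.1 x.2 (L t).

(** Averaging [traj_prob] over the initial state [s] with weights [m] turns the
indicator of [tau_0 = s] into [m]; a trajectory is then a path of the
state-action chain whose marginals are [d], and [path_additive] applies. *)
Lemma mean_expected_reward pi L m d :
    is_policy pi -> is_mfflow L -> occupation pi L m d ->
  \sum_s m s * expected_reward g pi L s = total_reward L d.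
Proof.
move=> pi_pol flL [[bal0 balS] drv].
pose k (t : 'I_T) (x x' : S * A) :=
  trans g (cur_time t) x.1 x.2 (L (cur_time t)) x'.1 * pi (next_time t) x'.1 x'.2.
have k1 t x : \sum_x' k t x x' = 1.
  rewrite sum_stateaction /k /=.
  under eq_bigr do rewrite -mulr_sumr (pi_pol _ _).2 mulr1.
  exact: (trans_distr g _ _ _ (flL _)).2.
have dS t x' : d (next_time t) x' = \sum_x d (cur_time t) x * k t x x'.
  case: x' => s' a'; rewrite drv balS sum_stateaction mulr_sumr.
  apply: eq_bigr => s _; rewrite mulr_sumr; apply: eq_bigr => a _.
  by rewrite /k /= mulrC mulrA.
rewrite /total_reward -(path_additive
  (fun (t : 'I_T.+1) x => reward g t x.1 x.2 (L t)) k1 dS).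
under eq_bigr do rewrite mulr_sumr.
rewrite exchange_big /=; apply: eq_bigr => tau _.
under eq_bigr do rewrite mulrA.
rewrite -mulr_suml; congr (_ * _).
rewrite (bigD1 (tau ord0).1) //= big1 ?addr0 => [|s]; last first.
  by rewrite eq_sym /traj_prob => /negPf->; rewrite !mul0r mulr0.
rewrite /traj_prob eqxx mul1r big_ord_recl /= -!mulrA -big_split /= mulrA.
rewrite (surjective_pairing (tau ord0)) drv bal0 /= [pi _ _ _ * m _]mulrC.
by congr (_ * _); apply: eq_bigr => t _; rewrite /k mulrC.
Qed.

Lemma expected_rewardE pi L s d :
    is_policy pi -> is_mfflow L ->
    occupation pi L (fun s' => (s' == s)%:R) d ->
  expected_reward g pi L s = total_reward L d.
Proof.
move=> pi_pol flL occ; rewrite -(mean_expected_reward pi_pol flL occ).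
rewrite (bigD1 s) //= eqxx mul1r big1 ?addr0 // => s' /negPf->.
by rewrite mul0r.
Qed.

(** The sum over [u] selects the successor of [t]: it is empty at the last
time, which encodes the convention [V_(T+1) = 0]. *)
Definition continuation L V (t : 'I_T.+1) (s : S) (a : A) : R :=
  \sum_(u < T | cur_time u == t)
     \sum_s' trans g t s a (L t) s' * V (next_time u) s'.

Lemma continuation_cur L V (t : 'I_T) s a :
  continuation L V (cur_time t) s a =
  \sum_s' trans g (cur_time t) s a (L (cur_time t)) s' * V (next_time t) s'.
Proof.
by rewrite /continuation (big_pred1 t).
Qed.

Lemma continuation_last L V s a : continuation L V ord_max s a = 0.
Proof.
rewrite /continuation big_pred0 // => u; apply/negbTE/eqP => /(congr1 val) /= eqT.
by have := ltn_ord u; rewrite eqT ltnn.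
Qed.

(** * The Bellman equation with slack *)

Definition bellman L V z : Prop :=
  forall t s a,
    reward g t s a (L t) + continuation L V t s a + z t (s, a) = V t s.

Definition slack_cost d z : R := \sum_t \sum_x z t x * d t x.

(** Performance-difference identity.  Conservation of mass says that the expected
continuation value at time [t] is the expected value at [t + 1], so the values
telescope. *)
Lemma total_reward_bellman L m d V z :
    flow_balance L m d -> bellman L V z ->
  total_reward L d = \sum_s m s * V ord0 s - slack_cost d z.
Proof.
move=> [bal0 balS] bel; apply/eqP; rewrite eq_sym subr_eq /total_reward /slack_cost.
pose val_at t := \sum_x d t x * V t x.1.
pose cont_at t := \sum_x d t x * continuation L V t x.1 x.2.
have contS (t : 'I_T) : cont_at (cur_time t) = val_at (next_time t).
  rewrite /cont_at /val_at sum_stateaction [RHS]sum_stateaction /=.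
  under [RHS]eq_bigr do rewrite -mulr_suml balS mulr_suml.
  rewrite [RHS]exchange_big /=; apply: eq_bigr => s _.
  under [RHS]eq_bigr do rewrite mulr_suml.
  rewrite [RHS]exchange_big /=; apply: eq_bigr => a _.
  rewrite continuation_cur mulr_sumr; apply: eq_bigr => s' _.
  by rewrite mulrA.
have contT : cont_at ord_max = 0.
  by apply: big1 => x _; rewrite continuation_last mulr0.
have val0 : val_at ord0 = \sum_s m s * V ord0 s.
  rewrite /val_at sum_stateaction /=.
  by under eq_bigr do rewrite -mulr_suml bal0.
have valE : \sum_t val_at t = \sum_s m s * V ord0 s + \sum_t cont_at t.
  rewrite big_ord_recl val0 [in RHS]big_ord_recr /= contT addr0; congr (_ + _).
  by apply: eq_bigr => t _; rewrite -[lift ord0 t]/(next_time t) -contS.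
apply/eqP; apply: (addIr (\sum_t cont_at t)); rewrite -valE -!big_split /=.
apply: eq_bigr => t _; rewrite -!big_split /=; apply: eq_bigr => -[s a] _ /=.
by rewrite -(bel t s a) !mulrDr [z t _ * _]mulrC addrAC.
Qed.

(** Dynamic programming: [V] is the backward recursion with a maximum over
actions, and the slack [z] vanishes at a maximizer. *)
Lemma optimal_values L (a0 : A) :
  exists V z,
    [/\ bellman L V z, forall t x, 0 <= z t x &
        exists greedy : 'I_T.+1 -> S -> A, forall t s, z t (s, greedy t s) = 0].
Proof.
pose best (h : A -> R) : A := [arg max_(a > a0) h a]%O.
have bestP h a : h a <= h (best h) by rewrite /best; case: arg_maxP => // b _; exact.
pose Q (t : 'I_T.+1) (v : S -> R) s a :=
  reward g t s a (L t) + \sum_s' trans g t s a (L t) s' * v s'.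
have [V [VT VS]] := backward_recursion (fun=> 0 : R)
  (fun t v s => Q t v s (best (Q t v s))).
pose q t s a := reward g t s a (L t) + continuation L V t s a.
have VE t s : V t s = q t s (best (q t s)).
  move: t s; apply: time_last => [t|] s.
    rewrite VS; have -> // : q (cur_time t) s = Q (cur_time t) (V (next_time t)) s.
    by apply: funext => a; rewrite /q continuation_cur.
  rewrite VT; have -> // : q ord_max s = Q ord_max (fun=> 0) s.
  apply: funext => a; rewrite /q /Q continuation_last; congr (_ + _).
  by rewrite big1 // => s' _; rewrite mulr0.
exists V, (fun t => [ffun x => V t x.1 - q t x.1 x.2]); split.
- by move=> t s a; rewrite ffunE /= addrC subrK.
- by move=> t [s a]; rewrite ffunE /= subr_ge0 VE.
- by exists (fun t s => best (q t s)) => t s; rewrite ffunE /= VE subrr.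
Qed.

(** * Policies that drive a flow *)

Lemma driven_by_in_Pi d pi :
  (forall t x, 0 <= d t x) -> in_Pi d pi -> driven_by pi d /\ is_policy pi.
Proof.
move=> d0 Pi; split=> [t s a|t s]; have [Hpos Hnull] := Pi t s.
  have [pos|/negbTE npos] := boolP (0 < \sum_a' d t (s, a')).
    by rewrite Hpos // divfK // gt_eqF.
  have sum0 : \sum_a' d t (s, a') = 0.
    apply/eqP; rewrite eq_le leNgt npos /= sumr_ge0 // => a' _; exact: d0.
  rewrite sum0 mulr0; apply/eqP.
  by have /eqP := sum0; rewrite psumr_eq0 // => /allP/(_ a); rewrite mem_index_enum; exact.
have [pos|] := boolP (0 < \sum_a' d t (s, a')); last exact: Hnull.
split=> [a|]; first by rewrite Hpos // divr_ge0 // sumr_ge0.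
under eq_bigr do rewrite Hpos //.
by rewrite -mulr_suml divff // gt_eqF.
Qed.

(** Where [d] has mass, the proportionality constraint makes [l] split over the
actions as [d] does.  Elsewhere [l] vanishes: by induction on time, a state
without [d]-mass is entered only with probability 0 from pairs [(s, a)] charged
by [d], and the pairs not charged by [d] are not charged by [l]. *)
Lemma driven_by_proportional pi L m (m' : S -> R) d l :
    is_mfflow L -> (forall t x, 0 <= d t x) -> (forall t x, 0 <= l t x) ->
    (forall s, 0 < m s) -> flow_balance L m d -> flow_balance L m' l ->
    driven_by pi d ->
    (forall s a t, l t (s, a) * \sum_a' d t (s, a') =
                   d t (s, a) * \sum_a' l t (s, a')) ->
  driven_by pi l.
Proof.
move=> flL d0 l0 mpos [dbal0 dbalS] [lbal0 lbalS] drv prop.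
have live t s : \sum_a d t (s, a) != 0 ->
    forall a, l t (s, a) = pi t s a * \sum_a' l t (s, a').
  move=> nz a; apply: (mulIf nz).
  by rewrite prop [d t (s, a)]drv -!mulrA [X in _ * X]mulrC.
have dominated t s : \sum_a d t (s, a) = 0 -> forall a, l t (s, a) = 0.
  elim/time_ind: t s => [|t IH] s sum0 a.
    by have := mpos s; rewrite -dbal0 sum0 ltxx.
  suff {a} sum0l : \sum_a l (next_time t) (s, a) = 0.
    exact: psumr_eq0P (fun a _ => l0 (next_time t) (s, a)) sum0l a isT.
  rewrite lbalS.
  have P0 t' s' a' : 0 <= trans g t' s' a' (L t') s.
    exact: (trans_distr g _ _ _ (flL _)).1.
  apply: big1 => s' _; apply: big1 => a' _.
  have /eqP : d (cur_time t) (s', a')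
              * trans g (cur_time t) s' a' (L (cur_time t)) s = 0.
    have dP0 b c : 0 <= d (cur_time t) (b, c)
                        * trans g (cur_time t) b c (L (cur_time t)) s.
      exact: mulr_ge0.
    rewrite dbalS in sum0.
    have /(_ s' isT) := psumr_eq0P (fun b _ => sumr_ge0 _ (fun c _ => dP0 b c)) sum0.
    by move/(psumr_eq0P (fun c _ => dP0 s' c))/(_ a' isT).
  rewrite mulf_eq0 => /orP[/eqP d_eq0|/eqP->]; last by rewrite mulr0.
  suff -> : l (cur_time t) (s', a') = 0 by rewrite mul0r.
  (* The pair is not charged by [d]: either its state has no [d]-mass, or the
     proportionality constraint applies there. *)
  have [z0|nz] := eqVneq (\sum_b d (cur_time t) (s', b)) 0; first exact: IH.
  by apply: (mulIf nz); rewrite prop d_eq0 !mul0r.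
move=> t s a; have [z0|nz] := eqVneq (\sum_a d t (s, a)) 0; last exact: live.
by rewrite dominated // big1 ?mulr0 // => a' _; exact: dominated.
Qed.


(** * The matrix form of conservation of mass and of the Bellman equation *)

Lemma Zmx_flat (f : {ffun S * A -> R}) :
  Zmx R S A *m flat f = \col_(s < #|S|) \sum_a f (enum_val s, a).
Proof.
rewrite /Zmx /flat mul_mxrow_mxcol; apply/colP => s; rewrite summxE mxE.
rewrite [RHS](reindex (@enum_val A predT)) /=; last exact/onW_bij/enum_val_bij.
by apply: eq_bigr => a _; rewrite mul1mx mxE.
Qed.

Lemma Wmx_flat t (l f : {ffun S * A -> R}) :
  Wmx g t l *m flat f =
  \col_(s' < #|S|) \sum_s \sum_a f (s, a) * trans g t s a l (enum_val s').
Proof.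
rewrite /Wmx /flat mul_mxrow_mxcol; apply/colP => s'; rewrite summxE mxE exchange_big.
rewrite [RHS](reindex (@enum_val A predT)) /=; last exact/onW_bij/enum_val_bij.
apply: eq_bigr => a _; rewrite mxE.
rewrite [RHS](reindex (@enum_val S predT)) /=; last exact/onW_bij/enum_val_bij.
by apply: eq_bigr => s _; rewrite !mxE mulrC.
Qed.

Lemma trZmx_col (v : S -> R) :
  (Zmx R S A)^T *m \col_(s < #|S|) v (enum_val s) = flat [ffun x => v x.1].
Proof.
rewrite /Zmx tr_mxrow mxcol_mul /flat; apply: eq_mxcol => a.
by rewrite trmx1 mul1mx; apply/colP => s; rewrite !mxE ffunE.
Qed.

Lemma trWmx_col t (l : {ffun S * A -> R}) (v : S -> R) :
  (Wmx g t l)^T *m \col_(s < #|S|) v (enum_val s) =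
  flat [ffun x => \sum_s' trans g t x.1 x.2 l s' * v s'].
Proof.
rewrite /Wmx tr_mxrow mxcol_mul /flat; apply: eq_mxcol => a.
apply/colP => s; rewrite !mxE ffunE /=.
rewrite [RHS](reindex (@enum_val S predT)) /=; last exact/onW_bij/enum_val_bij.
by apply: eq_bigr => s' _; rewrite !mxE.
Qed.

Lemma Amx_flow_vec L (m : {ffun S -> R}) d :
  Amx g L *m flow_vec d = last_block T m <-> flow_balance L m d.
Proof.
pose blk (i j : 'I_T.+1) : 'M[R]_(#|S|, dimSA S A) :=
  if (i < T)%N then
    if j == i :> nat then Wmx g i (L i)
    else if j == i.+1 :> nat then - Zmx R S A else 0
  else if j == 0%N :> nat then Zmx R S A else 0.
have -> : Amx g L *m flow_vec d =
    \mxcol_(i < T.+1) \sum_(j < T.+1) blk i j *m flat (d j).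
  by rewrite /Amx /flow_vec mul_mxblock_mxrow.
rewrite /last_block.
have cur_row (t : 'I_T) : \sum_j blk (cur_time t) j *m flat (d j) =
    Wmx g (cur_time t) (L (cur_time t)) *m flat (d (cur_time t))
    - Zmx R S A *m flat (d (next_time t)).
  have neq : next_time t != cur_time t.
    by rewrite -val_eqE /= /bump leq0n add1n neq_ltn ltnSn orbT.
  rewrite (bigD1 (cur_time t)) //= (bigD1 (next_time t)) //= big1 => [|j].
    rewrite /blk /= ltn_ord eqxx /bump leq0n add1n (gtn_eqF (ltnSn t)) eqxx addr0.
    by rewrite mulNmx.
  rewrite /blk /= ltn_ord => /andP[/negPf jcur /negPf jnext].
  by rewrite -!val_eqE /= /bump leq0n add1n in jcur jnext; rewrite jcur jnext mul0mx.
have last_row : \sum_j blk ord_max j *m flat (d j) = Zmx R S A *m flat (d ord0).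
  rewrite (bigD1 ord0) //= big1 => [|j j0]; first by rewrite /blk /= ltnn addr0.
  by rewrite -val_eqE /= in j0; rewrite /blk /= ltnn (negPf j0) mul0mx.
rewrite -eq_mxcolP; split=> [eqs|[bal0 balS]].
  split=> [s|t s'].
    have /colP/(_ (enum_rank s)) := eqs ord_max.
    by rewrite last_row Zmx_flat eqxx !mxE enum_rankK.
  have /colP/(_ (enum_rank s')) := eqs (cur_time t).
  rewrite cur_row Zmx_flat Wmx_flat /= (ltn_eqF (ltn_ord t)) !mxE enum_rankK.
  by move/subr0_eq.
apply: time_last => [t|].
  rewrite cur_row Zmx_flat Wmx_flat /= (ltn_eqF (ltn_ord t)).
  by apply/colP => s; rewrite !mxE balS subrr.
rewrite last_row Zmx_flat eqxx; apply/colP => s.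
by rewrite !mxE bal0.
Qed.

(** The dual variable attached to values [V].  Block row [t < T] of [A_L] carries
the mass from [t] to [t + 1], so its multiplier is [V_(t+1)]; the last block row
prescribes the initial mass, and it gets [- V_0] because [Z] enters it with the
sign opposite to that of the other rows. *)
Definition multiplier V : 'cV[R]_(\sum_(i < T.+1) #|S|) :=
  \mxcol_(i < T.+1) \col_(s < #|S|)
    oapp (fun t : 'I_T => V (next_time t) (enum_val s)) (- V ord0 (enum_val s))
         (unlift ord_max i).

Lemma multiplier_cur V (t : 'I_T) :
  submxcol (multiplier V) (cur_time t) = \col_(s < #|S|) V (next_time t) (enum_val s).
Proof.
rewrite /multiplier mxcolK; have -> : cur_time t = lift ord_max t.
  by apply: val_inj; rewrite /= /bump leqNgt ltn_ord.
by rewrite liftK.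
Qed.

Lemma multiplier_last V :
  submxcol (multiplier V) ord_max = \col_(s < #|S|) - V ord0 (enum_val s).
Proof. by rewrite /multiplier mxcolK unlift_none. Qed.

Lemma multiplier_surj (y : 'cV[R]_(\sum_(i < T.+1) #|S|)) :
  exists V, multiplier V = y.
Proof.
exists (fun t s => oapp (fun u : 'I_T => submxcol y (cur_time u) (enum_rank s) 0)
  (- submxcol y ord_max (enum_rank s) 0) (unlift ord0 t)).
apply/mxcolP; apply: time_last => [t|].
  by rewrite multiplier_cur; apply/colP => s; rewrite mxE liftK /= enum_valK.
rewrite multiplier_last; apply/colP => s.
by rewrite mxE unlift_none /= opprK enum_valK.
Qed.

Lemma trAmx_multiplier L V :
  (Amx g L)^T *m multiplier V =
  flow_vec (fun t => [ffun x => continuation L V t x.1 x.2 - V t x.1]).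
Proof.
rewrite /Amx tr_mxblock -[multiplier V]submxcolK mul_mxblock_mxrow /flow_vec.
apply: eq_mxcol => j; rewrite big_ord_recr /= ltnn multiplier_last.
have colN : \col_(s < #|S|) - V ord0 (enum_val s) = - \col_(s < #|S|) V ord0 (enum_val s).
  by apply/colP => s; rewrite !mxE.
(* The entries [- Z], one block to the right of the [W_t], and the entry [Z]
   of the last row pair with [V_1, ..., V_T] and [- V_0]: together they
   contribute [- Z^T V_j] in every block column [j]. *)
transitivity (\sum_(t < T) (if cur_time t == j then
      (Wmx g j (L j))^T *m \col_(s < #|S|) V (next_time t) (enum_val s) else 0)
   - \sum_(t < T.+1) (if t == j then
      (Zmx R S A)^T *m \col_(s < #|S|) V t (enum_val s) else 0)).
  rewrite [in RHS]big_ord_recl opprD addrCA [RHS]addrC -sumrN -big_split /=.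
  congr (_ + _).
    apply: eq_bigr => t _; rewrite -/(cur_time t) multiplier_cur ltn_ord.
    rewrite -!val_eqE /= /bump leq0n add1n ![_ == val j]eq_sym.
    case: eqVneq => [jt|_].
      have {jt}-> : j = cur_time t by apply: val_inj.
      by rewrite /= (ltn_eqF (ltnSn t)) subr0.
    by rewrite add0r; case: ifP => _; rewrite ?oppr0 ?trmx0 ?mul0mx // linearN mulNmx.
  rewrite -val_eqE /= eq_sym colN.
  by case: ifP => _; rewrite ?trmx0 ?mul0mx ?oppr0 // mulmxN.
rewrite -[in X in _ - X]big_mkcond big_pred1_eq trZmx_col -big_mkcond /=.
have flatB (f h : {ffun S * A -> R}) :
    flat f - flat h = flat [ffun x => f x - h x].
  by apply/matrixP => i k; rewrite !mxE ffunE.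
elim/time_last: j => [u|].
  rewrite (big_pred1 u) // trWmx_col flatB; apply: (congr1 (@flat R S A)).
  by apply/ffunP => x; rewrite !ffunE continuation_cur.
rewrite big_pred0 => [|u]; last by rewrite -val_eqE /= ltn_eqF.
by apply/matrixP => i k; rewrite !mxE !ffunE continuation_last.
Qed.


Lemma flow_vec_fnK d : vec_flow (flow_vec d) = d.
Proof. by apply: funext => t; rewrite flow_vecK. Qed.

Lemma dual_feasibleP L V z :
  (Amx g L)^T *m multiplier V + flow_vec z = cvec g L <-> bellman L V z.
Proof.
rewrite trAmx_multiplier.
set res := fun t => [ffun x => _].
have -> : flow_vec res + flow_vec z = flow_vec (fun t => [ffun x => res t x + z t x]).
  by apply/matrixP => i k; rewrite !mxE [RHS]ffunE.
split=> [/(congr1 (@vec_flow R S A T)) | bel].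
  rewrite /cvec !flow_vec_fnK => eqf t s a.
  have := congr1 (fun f : flow R S A T => f t (s, a)) eqf.
  by rewrite !ffunE /= => /eqP; rewrite -subr_eq0 opprK => /eqP eq0;
     apply/eqP; rewrite -subr_eq0 -eq0; apply/eqP; ring.
congr flow_vec; apply: funext => t; apply/ffunP => -[s a].
by rewrite !ffunE /= -(bel t s a); ring.
Qed.

Lemma nonneg_flow_vec d : nonneg (flow_vec d) <-> forall t x, 0 <= d t x.
Proof.
split=> [d0 t x | d0 i]; last by rewrite !mxE.
by rewrite -[d t]flow_vecK /vec_flow !ffunE [submxcol _ _ _ _]mxE [submxcol _ _ _ _]mxE.
Qed.

Lemma complementaryP z d :
  (flow_vec z)^T *m flow_vec d = 0 <-> slack_cost d z = 0.
Proof.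
have -> : (flow_vec z)^T *m flow_vec d = (slack_cost d z)%:M.
  rewrite /flow_vec tr_mxcol mul_mxrow_mxcol /slack_cost raddf_sum.
  apply: eq_bigr => t _; rewrite /flat tr_mxcol mul_mxrow_mxcol.
  rewrite sum_stateaction exchange_big raddf_sum /=.
  rewrite [RHS](reindex (@enum_val A predT)) /=; last exact/onW_bij/enum_val_bij.
  apply: eq_bigr => a _; apply/matrixP => i j; rewrite !mxE !ord1 mulr1n.
  rewrite [RHS](reindex (@enum_val S predT)) /=; last exact/onW_bij/enum_val_bij.
  by apply: eq_bigr => s _; rewrite !mxE.
split=> [/matrixP/(_ 0 0)|->]; first by rewrite !mxE mulr1n.
by rewrite raddf0.
Qed.

(** * Optimality and complementary slackness *)

Lemma expected_reward_slack pi L s V z d :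
    is_policy pi -> is_mfflow L -> bellman L V z ->
    occupation pi L (fun s' => (s' == s)%:R) d ->
  expected_reward g pi L s = V ord0 s - slack_cost d z.
Proof.
move=> pi_pol flL bel occ.
rewrite (expected_rewardE pi_pol flL occ) (total_reward_bellman occ.1 bel).
rewrite (bigD1 s) //= eqxx mul1r big1 ?addr0 // => s' /negPf->.
by rewrite mul0r.
Qed.

Lemma slack_cost_ge0 d z :
  (forall t x, 0 <= d t x) -> (forall t x, 0 <= z t x) -> 0 <= slack_cost d z.
Proof.
by move=> d0 z0; apply: sumr_ge0 => t _; apply: sumr_ge0 => x _; rewrite mulr_ge0.
Qed.

Lemma expected_reward_le pi L V z s :
    is_policy pi -> is_mfflow L -> bellman L V z -> (forall t x, 0 <= z t x) ->
  expected_reward g pi L s <= V ord0 s.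
Proof.
move=> pi_pol flL bel z0.
have [d occ] := occupation_exists L (fun s' => (s' == s)%:R) pi_pol.
rewrite (expected_reward_slack pi_pol flL bel occ) gerBl slack_cost_ge0 //.
by apply: (occupation_ge0 pi_pol flL _ occ) => s'; rewrite ler0n.
Qed.

Lemma slack_cost_greedy pi L m z d (greedy : 'I_T.+1 -> S -> A) :
    occupation pi L m d ->
    (forall t s a, pi t s a = (a == greedy t s)%:R) ->
    (forall t s, z t (s, greedy t s) = 0) ->
  slack_cost d z = 0.
Proof.
move=> [_ drv] piE zE; apply: big1 => t _; apply: big1 => -[s a] _.
rewrite drv piE; have [->|_] := eqVneq a (greedy t s); first by rewrite zE mul0r.
by rewrite mul0r mulr0.
Qed.

Lemma greedy_attains L V z (greedy : 'I_T.+1 -> S -> A) :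
    is_mfflow L -> bellman L V z -> (forall t s, z t (s, greedy t s) = 0) ->
  exists2 pi, is_policy pi & forall s, expected_reward g pi L s = V ord0 s.
Proof.
move=> flL bel zE.
pose pi : policy R S A T := fun t s => [ffun a => (a == greedy t s)%:R].
have pi_pol : is_policy pi.
  move=> t s; split=> [a|]; first by rewrite ffunE ler0n.
  under eq_bigr do rewrite ffunE.
  by rewrite (bigD1 (greedy t s)) //= eqxx big1 ?addr0 // => a /negPf->.
exists pi => // s.
have [d occ] := occupation_exists L (fun s' => (s' == s)%:R) pi_pol.
rewrite (expected_reward_slack pi_pol flL bel occ) (slack_cost_greedy occ _ zE) ?subr0 //.
by move=> t s' a; rewrite ffunE.
Qed.

(** [slack_cost d z] is the [m]-average of the gaps [V_0(s) - E_s], which are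
nonnegative; positivity of [m] makes the average vanish only if all gaps do. *)
Lemma optimal_iff_slack_cost0 pi L V z m d :
    is_policy pi -> is_mfflow L -> bellman L V z -> (forall t x, 0 <= z t x) ->
    (forall s, 0 < m s) -> occupation pi L m d ->
  slack_cost d z = 0 <-> forall s, expected_reward g pi L s = V ord0 s.
Proof.
move=> pi_pol flL bel z0 mpos occ.
have := mean_expected_reward pi_pol flL occ.
rewrite (total_reward_bellman occ.1 bel) => /esym/eqP; rewrite subr_eq => /eqP sumE.
split=> [cost0 s|opt].
  apply/eqP; rewrite eq_sym -subr_eq0; apply/eqP.
  apply: (mulfI (lt0r_neq0 (mpos s))); rewrite mulr0.
  apply: (psumr_eq0P (P := predT)
    (F := fun s => m s * (V ord0 s - expected_reward g pi L s))) => //.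
    move=> s' _; rewrite mulr_ge0 ?(ltW (mpos _)) // subr_ge0.
    exact: expected_reward_le bel z0.
  under eq_bigr do rewrite mulrBr.
  by rewrite sumrB sumE cost0 addr0 subrr.
move: sumE; under [X in _ = X + _]eq_bigr do rewrite opt.
by rewrite -[X in X = _ -> _]addr0 => /addrI/esym.
Qed.

Definition uniform : {ffun S -> R} := [ffun=> #|S|%:R^-1].

Lemma uniform_gt0 s : 0 < uniform s.
Proof. by rewrite ffunE invr_gt0 ltr0n; apply/card_gt0P; exists s. Qed.

Lemma distr_inhabited (X : finType) (p : {ffun X -> R}) : is_distr p -> exists x : X, True.
Proof.
move=> [_ sum1]; case: (pickP (@predT X)) => [x _|X0]; first by exists x.
by move: sum1; rewrite big_pred0 // => /eqP; rewrite eq_sym oner_eq0.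
Qed.

(** * The two directions of the equivalence *)

Lemma nash_solution pi L :
    refined_nash g pi L -> exists y zv dv, solution g y zv dv (flow_vec L).
Proof.
move=> [pi_pol flL opt law].
have occL := (is_law_occupation L pi_pol).1 law.
have [s0 _] := distr_inhabited (mu0_distr g).
have [a0 _] := distr_inhabited (pi_pol ord0 s0).
have [V [z [bel z0 [greedy zE]]]] := optimal_values L a0.
have [d occ] := occupation_exists L uniform pi_pol.
have d0 t x : 0 <= d t x.
  by apply: (occupation_ge0 pi_pol flL _ occ) => s; exact/ltW/uniform_gt0.
exists (multiplier V), (flow_vec z), (flow_vec d).
rewrite /solution !flow_vec_fnK; split=> //; split.
- by split; [apply/Amx_flow_vec; exact: occ.1 | apply/dual_feasibleP].
- split; [|exact/nonneg_flow_vec|exact/nonneg_flow_vec].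
  apply/complementaryP/(optimal_iff_slack_cost0 pi_pol flL bel z0 uniform_gt0 occ) => s.
  have [pi' pi'_pol eqV] := greedy_attains flL bel zE.
  by apply/eqP; rewrite eq_le (expected_reward_le _ pi_pol flL bel z0) -eqV opt.
- split; first by apply/Amx_flow_vec; exact: occL.1.
  by apply/nonneg_flow_vec => t; have [] := flL t.
- by move=> s a t; rewrite occ.2 [L t _]occL.2 mulrAC.
Qed.

Lemma solution_nash y zv dv Lv :
    solution g y zv dv Lv ->
  forall pi, in_Pi (vec_flow dv) pi -> refined_nash g pi (vec_flow Lv).
Proof.
have [V <-] := multiplier_surj y.
rewrite -[zv]vec_flowK -[dv]vec_flowK -[Lv]vec_flowK.
move: (vec_flow zv) (vec_flow dv) (vec_flow Lv) => z d L.
rewrite /solution !flow_vec_fnK.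
move=> [flL [[/Amx_flow_vec bal /dual_feasibleP bel]
  [/complementaryP cost0 /nonneg_flow_vec d0 /nonneg_flow_vec z0]
  [/Amx_flow_vec balL /nonneg_flow_vec L0] prop]] pi Pi.
have [drv pi_pol] := driven_by_in_Pi d0 Pi.
have drvL := driven_by_proportional flL d0 L0 uniform_gt0 bal balL drv prop.
have opt := (optimal_iff_slack_cost0 pi_pol flL bel z0 uniform_gt0 (conj bal drv)).1 cost0.
split=> // [s pi' pi'_pol|]; first by rewrite opt (expected_reward_le _ pi'_pol flL bel z0).
exact/(is_law_occupation L pi_pol).
Qed.

End GameTheory.

Local Close Scope ring_scope.


Theorem theorem16 (R : realType) (S A : finType) (T : nat)
    (g : mfgame R S A T) :
  (forall (pi : policy R S A T) (L : flow R S A T),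
     refined_nash g pi L ->
     exists (y : 'cV[R]_(\sum_(i < T.+1) #|S|))
            (z d : 'cV[R]_(\sum_(t < T.+1) dimSA S A)),
       solution g y z d (flow_vec L))
  /\
  (forall (y : 'cV[R]_(\sum_(i < T.+1) #|S|))
          (z d L : 'cV[R]_(\sum_(t < T.+1) dimSA S A)),
     solution g y z d L ->
     forall pi : policy R S A T, in_Pi (vec_flow d) pi ->
       refined_nash g pi (vec_flow L)).
Proof.
split=> [pi L|y z d L]; [exact: nash_solution | exact: solution_nash].
Qed.
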